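(* For all integers $n\ge2$ and $0\le k<n-1$, the group $\mathfrak G_{n,k}$ is a $(v,\kappa,\lambda)_0$ relative skew Hadamard difference set group for some parameters $v,\kappa,\lambda$ (with respect to some difference set $D$ and some subgroup $H$).
   Context: A $(v,\kappa,\lambda)$ difference set in a finite group $G$ with $|G|=v$ is a non-empty subset $D\subset G$ with $|D|=\kappa$ such that every $1\neq g\in G$ occurs exactly $\lambda$ times in the multiset $\{xy^{-1}:x,y\in D\}$. For $X\subseteq G$ write $X^{-1}=\{x^{-1}:x\in X\}$. A finite group $G$ is a $(v,\kappa,\lambda)_0$ relative skew Hadamard difference set group with difference set $D$ and subgroup $H$ if $D\subset G$ is a $(v,\kappa,\lambda)$ difference set, $1\ne H\le G$, $D\cap D^{-1}=\emptyset$ and $G\setminus(D\cup D^{-1})=H$. For $n\ge2$ and $0\le k<n-1$, $\mathfrak G_{n,k}$ is the group with generators $a_1,\dots,a_n,b_1,\dots,b_n$ and the following defining relations, where $x^y=y^{-1}xy$ and $(x,y)$ is the commutator: - $a_i^2=b_{i+k}$ for $1\le i\le n$ (indices taken mod $n$, in $\{1,\dots,n\}$); - $a_2^{a_1}=a_2b_1,\ a_3^{a_1}=a_3b_2,\ \dots,\ a_{k+1}^{a_1}=a_{k+1}b_k$ (no such relations if $k=0$); - $(a_1,a_{k+2})=(a_1,a_{k+3})=\dots=(a_1,a_n)=1$; - $(a_i,a_j)=1$ for $1<i,j\le n$; - $b_1,\dots,b_n$ are central involutions (i.e. $b_i^2=1$ and $b_i$ commutes with all generators). *)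

(* Defs.v *)
From HB Require Import structures.
From mathcomp Require Import all_boot all_fingroup generic_quotient.
From mathcomp Require Import boolp.

Set Implicit Arguments.
Unset Strict Implicit.
Unset Printing Implicit Defensive.

Local Open Scope quotient_scope.
Local Open Scope group_scope.

(* Groups given by generators and relations.  The letter (x, true) stands for
   the generator x and (x, false) for its inverse; R u v is the defining
   relation u = v. *)
Section Presentation.
Variable X : choiceType.

Definition word := seq (X * bool).

Definition winv (u : word) : word := rev [seq (l.1, ~~ l.2) | l <- u].
Definition wconj (u v : word) : word := winv v ++ u ++ v.
Definition wcomm (u v : word) : word := winv u ++ winv v ++ u ++ v.

Variable R : word -> word -> Prop.

Inductive weq : word -> word -> Prop :=
| weq_refl u : weq u u
| weq_sym u v : weq u v -> weq v u
| weq_trans u v w : weq u v -> weq v w -> weq u w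
| weq_cat u u' v v' : weq u u' -> weq v v' -> weq (u ++ v) (u' ++ v')
| weq_cancel x e : weq [:: (x, e); (x, ~~ e)] [::]
| weq_rel u v : R u v -> weq u v.

Definition weqb (u v : word) : bool := `[< weq u v >].

Fact weqb_refl : reflexive weqb.
Proof. by move=> u; apply/asboolP/weq_refl. Qed.

Fact weqb_sym : symmetric weqb.
Proof. by move=> u v; apply/asboolP/asboolP; apply: weq_sym. Qed.

Fact weqb_trans : transitive weqb.
Proof.
by move=> v u w /asboolP uv /asboolP vw; apply/asboolP/(weq_trans uv vw).
Qed.

Canonical weqb_equiv := EquivRel weqb weqb_refl weqb_sym weqb_trans.

Definition presented := {eq_quot weqb_equiv}.

HB.instance Definition _ := Choice.on presented.


Definition pres_one : presented := \pi_presented [::].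
Definition pres_mul (x y : presented) : presented := \pi_presented (repr x ++ repr y).
Definition pres_inv (x : presented) : presented := \pi_presented (winv (repr x)).

Lemma pres_piP (u v : word) : weq u v <-> \pi_presented u = \pi_presented v.
Proof.
split=> [uv|/eqP]; first by apply/eqP; rewrite piE; apply/asboolP.
by rewrite piE => /asboolP.
Qed.

Lemma weq_repr (u : word) : weq (repr (\pi_presented u)) u.
Proof. by apply/pres_piP; rewrite reprK. Qed.

Lemma weq_mulV (u : word) : weq (u ++ winv u) [::].
Proof.
elim: u => [|[x e] u IHu]; first exact: weq_refl.
have -> : ((x, e) :: u) ++ winv ((x, e) :: u) =
    [:: (x, e)] ++ (u ++ winv u) ++ [:: (x, ~~ e)].
  by rewrite /winv /= rev_cons -cats1 !catA.
apply: weq_trans (weq_cancel x e); rewrite -[[:: _; _]]/([:: _] ++ [::] ++ _).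
apply: weq_cat; first exact: weq_refl.
exact: weq_cat IHu (weq_refl _).
Qed.

Lemma winvK : involutive winv.
Proof.
move=> u; rewrite /winv map_rev revK -map_comp -[RHS]map_id.
by apply: eq_map => -[x e] /=; rewrite negbK.
Qed.

Lemma weq_mulVw (u : word) : weq (winv u ++ u) [::].
Proof. by rewrite -{2}[u]winvK; apply: weq_mulV. Qed.

Lemma pres_mulA : associative pres_mul.
Proof.
move=> x y z; apply/pres_piP.
apply: weq_trans (weq_cat (weq_refl _) (weq_repr _)) _.
rewrite catA; apply: weq_cat (weq_refl _).
exact/weq_sym/weq_repr.
Qed.

Lemma pres_mul1 : left_id pres_one pres_mul.
Proof.
move=> x; rewrite -[RHS]reprK; apply/pres_piP.
rewrite -[X in weq _ X]cat0s.
exact: weq_cat (weq_repr _) (weq_refl _).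
Qed.

Lemma pres_mulr1 : right_id pres_one pres_mul.
Proof.
move=> x; rewrite -[RHS]reprK; apply/pres_piP.
rewrite -[X in weq _ X]cats0.
exact: weq_cat (weq_refl _) (weq_repr _).
Qed.

Lemma pres_mulV : left_inverse pres_one pres_inv pres_mul.
Proof.
move=> x; apply/pres_piP; apply: weq_trans (weq_mulVw (repr x)).
exact: weq_cat (weq_repr _) (weq_refl _).
Qed.

Lemma pres_mulrV : right_inverse pres_one pres_inv pres_mul.
Proof.
move=> x; apply/pres_piP; apply: weq_trans (weq_mulV (repr x)).
exact: weq_cat (weq_refl _) (weq_repr _).
Qed.

HB.instance Definition _ := isGroup.Build presented
  pres_mulA pres_mul1 pres_mulr1 pres_mulV pres_mulrV.

End Presentation.

(* The groups G_{n,k}.  Indices are 0-based: ga i and gb i, for i : 'I_n, are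
   the generators usually written a_{i+1} and b_{i+1}. *)
Section GGroup.
Variables n k : nat.

Definition ga (i : 'I_n) : word ('I_n + 'I_n)%type := [:: (inl i, true)].
Definition gb (i : 'I_n) : word ('I_n + 'I_n)%type := [:: (inr i, true)].

Inductive Grel : word ('I_n + 'I_n)%type -> word ('I_n + 'I_n)%type -> Prop :=
| Grel_sqr (i j : 'I_n) : val j = (i + k) %% n ->
    Grel (ga i ++ ga i) (gb j)
| Grel_conj (z i j : 'I_n) : val z = 0 -> val j = i.+1 -> j <= k ->
    Grel (wconj (ga j) (ga z)) (ga j ++ gb i)
| Grel_comm1 (z j : 'I_n) : val z = 0 -> k < j ->
    Grel (wcomm (ga z) (ga j)) [::]
| Grel_comm (i j : 'I_n) : 0 < i -> 0 < j ->
    Grel (wcomm (ga i) (ga j)) [::]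
| Grel_b_sqr (i : 'I_n) : Grel (gb i ++ gb i) [::]
| Grel_b_a (i j : 'I_n) : Grel (wcomm (gb i) (ga j)) [::]
| Grel_b_b (i j : 'I_n) : Grel (wcomm (gb i) (gb j)) [::].

Definition Ggroup : groupType := presented Grel.

End GGroup.

Definition difference_set (gT : finGroupType) (v kappa lambda : nat)
    (D : {set gT}) : Prop :=
  [/\ #|[set: gT]| = v, D != set0, #|D| = kappa &
      forall g : gT, g != 1 ->
        #|[set p in setX D D | p.1 * p.2^-1 == g]| = lambda].

Definition rel_skew_hadamard (gT : finGroupType) (v kappa lambda : nat)
    (D : {set gT}) (H : {group gT}) : Prop :=
  [/\ difference_set v kappa lambda D, H :!=: 1,
      D :&: D^-1 = set0 & ~: (D :|: D^-1) = H].

(* G need not come with a finType structure: its finiteness is the existence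
   of the isomorphism phi onto a finite group. *)
Definition rel_skew_hadamard_group (G : groupType) (v kappa lambda : nat) :
    Prop :=
  exists (gT : finGroupType) (phi : {multiplicative G -> gT}),
    bijective phi /\
    exists (D : {set gT}) (H : {group gT}),
      rel_skew_hadamard v kappa lambda D H.

(* Main.v *)
Require Import Defs.
From HB Require Import structures.
From mathcomp Require Import all_boot all_fingroup all_algebra.
From mathcomp Require Import generic_quotient.
From mathcomp Require Import zify.

(** Write V for the vector space of binary row vectors of length n, with n >= 2,
    and let q v = B v v for a bilinear map B : V * V -> V.  The twisted product
    V x_B V, with law (v, b)(w, c) = (v + w, b + c + B v w), is a group of order
    2^(2n) in which (v, b)^2 = (0, q v), and the fibre 0 x V is central.  The
    group of the theorem is such a product: modulo the b_i the generators a_i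
    span V, and the defining relations prescribe exactly the squares B e_i e_i
    and the commutators B e_i e_j + B e_j e_i of a bilinear map, here called
    cocycle.  Normal forms a_1^v_1 ... a_n^v_n b_1^x_1 ... b_n^x_n multiply by
    this law (aexpM, normal_formM), which gives a left inverse to the morphism
    into the twisted product (to_twistK).

    In the twisted product take a McFarland-type set
      D = {(v, b) : v != 0 and h v is orthogonal to b},
    where h is an injection of V into itself fixing 0.  Each coset of the fibre
    but the fibre itself meets D in a hyperplane, and every hyperplane is used
    exactly once.  Translates of two distinct hyperplanes meet in 2^(n-2)
    vectors, and each nonzero vector lies in 2^(n-1) - 1 hyperplanes, so every
    nontrivial element has (2^n - 2) 2^n / 4 representations as a quotient of
    elements of D (quotients_in_fibre, quotients_off_fibre).  Since (v, b)^-1 = (v, b + q v),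
    inversion moves the hyperplane of the coset of v by q v.  Hence D^-1 is the
    complement of D outside the fibre as soon as h v is not orthogonal to q v
    for all v != 0, and then H = 0 x V.

    Two facts produce h.  First, q is injective: after a permutation of the
    coordinates, coordinate i of q v is v_i plus a function of earlier
    coordinates of v (cocycle_sqr_inj); this is where k < n - 1 enters.
    Secondly, V has a permutation x |-> x' fixing 0 with <x', x> = 1 for x != 0:
    keep the coordinates of x up to its first 1 and complement all later ones
    (tail_flip), so that the first 1 is the only common 1 of x and x'.  Then
    h v = (q v)' is as required. *)

Set Implicit Arguments.
Unset Strict Implicit.
Unset Printing Implicit Defensive.

Import GRing.Theory.

(** * Binary vectors *)

Section BinarySpace.

Variable n : nat.
Notation V := 'rV[bool]_n.
Implicit Types x y z b t : V.
Local Open Scope ring_scope.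

Lemma addvv_binary x : x + x = 0.
Proof. by apply/rowP=> i; rewrite !mxE; case: (x 0 i). Qed.

Lemma addVK_binary x : involutive (+%R x).
Proof. by move=> y; rewrite addrA addvv_binary add0r. Qed.

Lemma scale_bool (e : bool) x : e *: x = if e then x else 0.
Proof. by case: e; rewrite ?scale1r ?scale0r. Qed.

Lemma span_binary (P : V -> Prop) :
  P 0 -> (forall x y, P x -> P y -> P (x + y)) ->
  (forall i, P (delta_mx 0 i)) -> forall x, P x.
Proof.
move=> P0 PD Pe x; rewrite [x]row_sum_delta.
by apply: big_ind => // i _; rewrite scale_bool; case: ifP.
Qed.

Definition dot x y : bool := \sum_i x 0 i * y 0 i.

Lemma dotC x y : dot x y = dot y x.
Proof. by apply: eq_bigr => i _; rewrite mulrC. Qed.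

Lemma dotDr x y z : dot x (y + z) = dot x y (+) dot x z.
Proof.
by rewrite -[RHS]big_split /=; apply: eq_bigr => i _; rewrite mxE mulrDr.
Qed.

Lemma dot0r x : dot x 0 = false.
Proof. by apply: big1 => i _; rewrite mxE mulr0. Qed.

Lemma dot_delta x i : dot x (delta_mx 0 i) = x 0 i.
Proof.
rewrite /dot (bigD1 i) //= big1 => [|j ji].
  by rewrite mxE !eqxx mulr1 addr0.
by rewrite mxE (negPf ji) andbF mulr0.
Qed.

(** Translation by t preserves P and exchanges the two values of the functional
    y, which therefore splits P evenly. *)
Lemma card_half (P : pred V) y t s :
  (forall b, P (t + b) = P b) -> dot y t ->
  (#|[pred b | P b && (dot y b == s)]| * 2 = #|P|)%N.
Proof.
move=> Pt yt; rewrite -!sum1_card [RHS](bigID (fun b => dot y b == s)) /=.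
rewrite muln2 -addnn; congr addn.
rewrite [RHS](reindex_inj (addrI t)); apply: eq_bigl => b.
by rewrite !inE dotDr yt -!topredE /= Pt; case: (dot y b); case: s.
Qed.

Lemma card_dot y s : y != 0 -> (#|[pred b | dot y b == s]| * 2 = 2 ^ n)%N.
Proof.
case/rV0Pn=> i yi.
rewrite -[(#|_|)]/(#|[pred b | predT b && (dot y b == s)]|).
rewrite (@card_half predT _ (delta_mx 0 i)) ?dot_delta //; last first.
  by case: (y 0 i) yi.
by rewrite cardT -cardE card_mx card_bool mul1n.
Qed.

(** Over the two-element field, distinct nonzero functionals are linearly
    independent; this is the form of independence that card_half consumes. *)
Lemma dot_separates y z : y != 0 -> y != z ->
  exists2 t, dot y t & dot z t = false.
Proof.
move=> y0 yz.
have [i yi|zy] := pickP [pred i | y 0 i && ~~ z 0 i].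
  by exists (delta_mx 0 i); rewrite dot_delta; case/andP: yi => // _ /negPf.
(* Otherwise the support of y is strictly contained in that of z, and a sum of
   two unit vectors does it. *)
have {zy} yz_le i : y 0 i -> z 0 i.
  by move=> yi; move: (zy i) => /=; rewrite yi; case: (z 0 i).
have [i zi /negPf yi] : exists2 i, z 0 i & ~~ y 0 i.
  apply/exists_inP; rewrite -negb_forall_in; apply: contra yz => /forall_inP zy.
  apply/eqP/rowP=> i; move: (zy i) (yz_le i).
  case: (z 0 i); case: (y 0 i) => //= zi yi; [exact: zi|exact/esym/yi].
case/rV0Pn: y0 => j yj; exists (delta_mx 0 i + delta_mx 0 j).
  by rewrite dotDr !dot_delta yi; case: (y 0 j) yj.
by rewrite dotDr !dot_delta zi yz_le //; case: (y 0 j) yj.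
Qed.

Lemma card_dot2 y z s r : y != 0 -> z != 0 -> y != z ->
  (#|[pred b | (dot z b == r) && (dot y b == s)]| * 4 = 2 ^ n)%N.
Proof.
move=> y0 z0 yz; have [t yt zt] := dot_separates y0 yz.
rewrite -(card_dot r z0) -[4%N]/(2 * 2)%N mulnA; congr muln.
by apply: (card_half (t := t)) => // b; rewrite /= dotDr zt.
Qed.

Definition zero_below x i := [forall j : 'I_n, (j < i)%N ==> ~~ x 0 j].

(** An explicit permutation matching each nonzero vector with a functional that
    is nonzero on it; over the field with 2^n elements one could use instead
    x |-> Tr (c x^-1 -) with Tr c = 1. *)
Definition tail_flip x : V := \row_i (x 0 i (+) ~~ zero_below x i).

Lemma tail_flip0 : tail_flip 0 = 0.
Proof.
apply/rowP=> i; rewrite !mxE; suff -> : zero_below 0 i by [].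
by apply/forall_inP=> j _; rewrite mxE.
Qed.

(** The first 1 of x is kept, and every later 1 of x becomes a 0. *)
Lemma dot_tail_flip x : x != 0 -> dot (tail_flip x) x.
Proof.
case/rV0Pn=> i0 xi0.
case: (@arg_minnP _ i0 (fun i => x 0 i) val) => [|i xi mini].
  by case: (x 0 i0) xi0.
have bi : zero_below x i.
  by apply/forall_inP=> j; apply: contraTN => /mini; rewrite -leqNgt.
rewrite /dot (bigD1 i) //= big1 => [|j ji].
  by rewrite mxE bi xi.
rewrite mxE; case xj: (x 0 j); last by rewrite mulr0.
suff /negPf-> : ~~ zero_below x j by [].
have ij : (i < j)%N by rewrite ltn_neqAle eq_sym ji mini.
by apply/forall_inP=> /(_ i ij); rewrite xi.
Qed.

(** Whether coordinate i is complemented depends only on earlier coordinates,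
    so the vector can be recovered from left to right. *)
Lemma tail_flip_inj : injective tail_flip.
Proof.
move=> x y exy; apply/rowP=> -[i lti]; elim/ltn_ind: i lti => i IH lti.
have := congr1 (fun v : V => v 0 (Ordinal lti)) exy; rewrite !mxE.
suff -> : zero_below x (Ordinal lti) = zero_below y (Ordinal lti).
  exact: addIb.
by apply: eq_forallb => -[j ltj]; case: ltnP => //= ji; rewrite IH.
Qed.

End BinarySpace.

(** * Difference sets in twisted products *)

Section TwistedProduct.

Variable n : nat.
Notation V := 'rV[bool]_n.

(** The carrier of the central extension of V by V with 2-cocycle B;
    indexing the type by B gives each bilinear map its own group structure. *)
Definition twist of {bilinear V -> V -> V}%R : Type := (V * V)%type.

HB.instance Definition _ B := Finite.copy (twist B) (V * V)%type.

Variable B : {bilinear V -> V -> V}%R.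
Notation T := (twist B).
Implicit Types x y : T.

Definition twist_mul x y : T := (x.1 + y.1, x.2 + y.2 + B x.1 y.1)%R.
Definition twist_inv x : T := (x.1, x.2 + B x.1 x.1)%R.

Fact twist_mulA : associative twist_mul.
Proof.
move=> x y z; congr pair; rewrite /= ?addrA //.
by rewrite linearDr linearDl /= !addrA [RHS](ACl (1*2*4*6*3*5)%AC).
Qed.

Fact twist_mul1 : left_id (0%R, 0%R) twist_mul.
Proof. by move=> [v b]; rewrite /twist_mul /= linear0l !add0r addr0. Qed.

Fact twist_mulV : left_inverse (0%R, 0%R) twist_inv twist_mul.
Proof.
move=> [v b]; rewrite /twist_mul /= addvv_binary; congr pair.
by rewrite -addrA addvv_binary.
Qed.

HB.instance Definition _ :=
  Finite_isGroup.Build T twist_mulA twist_mul1 twist_mulV.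

Local Open Scope group_scope.

Lemma twistM x y : x * y = (x.1 + y.1, x.2 + y.2 + B x.1 y.1)%R.
Proof. by []. Qed.

Lemma twistV x : x^-1 = (x.1, x.2 + B x.1 x.1)%R.
Proof. by []. Qed.

Lemma twist_commute x y : B x.1 y.1 = B y.1 x.1 -> commute x y.
Proof.
move=> Bxy; rewrite /commute !twistM Bxy.
by rewrite [(y.1 + _)%R]addrC [(y.2 + _)%R]addrC.
Qed.

Variable h : V -> V.
Hypothesis h_inj : injective h.
Hypothesis h0 : h 0%R = 0%R.
(** The hyperplane orthogonal to h v must avoid the square B v v of the elements
    of the coset of v. *)
Hypothesis h_sqr : forall v : V, v != 0%R -> dot (h v) (B v v).

Definition mcfarland : {set T} :=
  [set x : T | (x.1 != 0%R) && ~~ dot (h x.1) x.2].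

Definition fibre : {set T} := [set x : T | x.1 == 0%R].

Fact fibre_group : group_set fibre.
Proof.
apply/group_setP; split=> [|x y]; rewrite !inE // => /eqP x0 /eqP y0.
by rewrite twistM /= x0 y0 addr0.
Qed.

Canonical fibre_Group := Group fibre_group.

Lemma h_neq0 v : v != 0%R -> h v != 0%R.
Proof. by rewrite -{2}h0 (inj_eq h_inj). Qed.

(** Inversion adds B v v to the second component, which changes the value of the
    functional h v. *)
Lemma mem_mcfarlandV x :
  (x \in mcfarland^-1) = (x.1 != 0%R) && dot (h x.1) x.2.
Proof.
rewrite mem_invg inE twistV /= dotDr; case: eqP => //= /eqP x0.
by rewrite h_sqr // addbT negbK.
Qed.

Lemma card_pairs (P : pred T) :
  #|P| = \sum_v #|[pred b | P (v, b)]|.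
Proof.
under eq_bigr do rewrite -sum1_card.
by rewrite pair_big_dep /= -sum1_card; apply: eq_bigl => -[v b].
Qed.

Lemma card_quotients (g : T) :
  #|[set p in setX mcfarland mcfarland | p.1 * p.2^-1 == g]| =
  #|[pred y | (y \in mcfarland) && ((g * y)%g \in mcfarland)]|.
Proof.
rewrite -(card_imset _ (f := fun y => (g * y, y))) => [|x y [] //].
apply: eq_card => -[x y]; rewrite !inE /=; apply/andP/imsetP => [|[z]].
  case=> /andP[Dx Dy] /eqP <-; exists y; last by rewrite mulgVK.
  by rewrite inE mulgVK !inE Dx Dy.
rewrite !inE => /andP[Dz Dgz] [-> ->].
by rewrite mulgK; split; rewrite ?Dz ?Dgz.
Qed.

Lemma card_nonzero_pred (P : pred V) : P 0%R ->
  #|[pred v | (v != 0%R) && P v]| = #|P|.-1.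
Proof.
by move=> P0; rewrite [in RHS](cardD1 0%R) [_ \in P]P0; apply: eq_card => v.
Qed.

(** A translation by (0, c) preserves the coset of w; it preserves the
    hyperplane there if c lies in it, and moves it off itself otherwise.  So the
    count is the number 2^(n-1) - 1 of hyperplanes through c times their size
    2^(n-1). *)
Lemma quotients_in_fibre (g : T) : g.1 = 0%R -> g.2 != 0%R ->
  (#|[pred y | (y \in mcfarland) && ((g * y)%g \in mcfarland)]| * 4 =
  (2 ^ n - 2) * 2 ^ n)%N.
Proof.
case: g => u c /= -> c0; rewrite card_pairs.
pose W := [pred v | (v != 0%R) && (dot c v == false)].
rewrite (eq_bigr (fun w => if W (h w)
    then #|[pred b | dot (h w) b == false]| else 0)) => [|w _]; last first.
  have -> : W (h w) = (w != 0%R) && ~~ dot (h w) c.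
    by rewrite /= -{1}h0 (inj_eq h_inj) dotC eqbF_neg.
  case: ifP => [/andP[w0 /negPf wc]|wc].
    apply: eq_card => b; rewrite !inE twistM /= add0r linear0l w0 addr0.
    by rewrite dotDr wc eqbF_neg andbb.
  apply: eq_card0 => b; rewrite !inE twistM /= add0r linear0l addr0 dotDr.
  by move: wc; case: eqP => //= _ /negbFE ->; case: dot.
rewrite -(reindex_inj h_inj (P := xpredT)
  (F := fun w => if W w then #|[pred b | dot w b == false]| else 0)).
rewrite -big_mkcond /= big_distrl /=.
rewrite (eq_bigr (fun=> (2 ^ n * 2)%N)) => [|w /andP[w0 _]]; last first.
  by rewrite -(card_dot false w0) -mulnA.
rewrite sum_nat_const card_nonzero_pred ?dot0r // -(card_dot false c0).
by case: #|_| => // m; rewrite succnK; nia.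
Qed.

(** A translation from the coset of w to that of u + w makes two different
    hyperplanes meet, up to a shift, in 2^(n-2) vectors; only the 2^n - 2 values
    of w other than 0 and u contribute. *)
Lemma quotients_off_fibre (g : T) : g.1 != 0%R ->
  (#|[pred y | (y \in mcfarland) && ((g * y)%g \in mcfarland)]| * 4 =
  (2 ^ n - 2) * 2 ^ n)%N.
Proof.
case: g => u c /= u0; rewrite card_pairs big_distrl /=.
rewrite (eq_bigr (fun w => if (w != 0%R) && (w != u) then 2 ^ n else 0)%N)
    => [|w _]; last first.
  have uw : (u + w == 0)%R = (w == u).
    by rewrite -[RHS](inj_eq (addrI u)) addvv_binary.
  case: ifP => [/andP[w0 wu]|wc].
    have hne : h w != h (u + w)%R.
      by rewrite (inj_eq h_inj) -{1}[w]add0r (inj_eq (addIr w)) eq_sym.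
    rewrite -(card_dot2 false (dot (h (u + w)%R) (c + B u w)%R)
       (h_neq0 w0) _ hne) ?h_neq0 ?uw //.
    congr muln; apply: eq_card => b; rewrite !inE twistM /= w0 uw wu /=.
    by rewrite addrAC !dotDr eqbF_neg; do 4!case: (dot _ _).
  apply/eqP; rewrite muln_eq0; apply/orP; left; apply/eqP/eq_card0 => b.
  rewrite !inE twistM /= uw.
  by case/nandP: (negbT wc) => /negPn->; rewrite //= andbF.
rewrite -big_mkcond sum_nat_const; congr muln.
rewrite (@card_nonzero_pred (fun w => w != u)) 1?eq_sym //.
by rewrite -[#|_|]/#|predC1 u| cardC1 card_mx card_bool mul1n; lia.
Qed.

Lemma mcfarland_rel_skew_hadamard : (0 < n)%N ->
  rel_skew_hadamard #|[set: T]| #|mcfarland| ((2 ^ n - 2) * 2 ^ n %/ 4)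
    mcfarland fibre_Group.
Proof.
move=> n_gt0; pose v : V := (const_mx true).
have v0 : v != 0%R by apply/eqP=> /rowP/(_ (Ordinal n_gt0)); rewrite !mxE.
split.
- split=> // [|g g1].
    by apply/set0Pn; exists (v, 0%R); rewrite inE /= v0 dot0r.
  rewrite card_quotients; apply/esym/eqP; rewrite -(eqn_pmul2r (isT : 0 < 4)).
  have cnt : (#|[pred y | (y \in mcfarland) && ((g * y)%g \in mcfarland)]| * 4 =
    (2 ^ n - 2) * 2 ^ n)%N.
    have [g0|] := eqVneq g.1 0%R; last exact: quotients_off_fibre.
    apply: quotients_in_fibre => //; apply: contra g1 => /eqP g20.
    by move: g0; case: (g) g20 => ? ? /= -> ->.
  by rewrite -cnt mulnK.
- apply/trivgPn; exists (0%R, v); first by rewrite inE.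
  by apply: contra v0 => /eqP[->].
- apply/setP=> x; rewrite in_setI mem_mcfarlandV !inE.
  by case: (x.1 == 0%R) => //=; case: dot.
apply/setP=> x; rewrite in_setC in_setU mem_mcfarlandV !inE.
by case: (x.1 == 0%R) => //=; case: dot.
Qed.

End TwistedProduct.

(** * Morphisms from presented groups *)

Section PresentedGroups.

Variables (X : choiceType) (R : word X -> word X -> Prop) (H : groupType).
Variable f : X -> H.
Implicit Types u v : word X.
Local Open Scope group_scope.
Local Open Scope quotient_scope.

Notation G := (presented R).

Definition pres_pi u : G := \pi_G u.

Lemma pres_pi_cat u v : pres_pi (u ++ v) = pres_pi u * pres_pi v.
Proof. by apply/pres_piP/weq_sym/weq_cat; apply: weq_repr. Qed.

Lemma pres_pi_winv u : pres_pi (winv u) = (pres_pi u)^-1.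
Proof.
by apply/esym/mulg1_eq; rewrite -pres_pi_cat; apply/pres_piP/weq_mulV.
Qed.

Lemma pres_pi_rel u v : R u v -> pres_pi u = pres_pi v.
Proof. by move=> Ruv; apply/pres_piP/weq_rel. Qed.

Lemma pres_pi_wconj u v : pres_pi (wconj u v) = pres_pi u ^ pres_pi v.
Proof. by rewrite !pres_pi_cat pres_pi_winv. Qed.

Lemma pres_pi_wcomm u v : pres_pi (wcomm u v) = [~ pres_pi u, pres_pi v].
Proof. by rewrite !pres_pi_cat !pres_pi_winv. Qed.

Definition word_val u : H := \prod_(l <- u) (if l.2 then f l.1 else (f l.1)^-1).

Lemma word_val1 x e : word_val [:: (x, e)] = if e then f x else (f x)^-1.
Proof. by rewrite /word_val big_seq1. Qed.

Lemma word_val_cat u v : word_val (u ++ v) = word_val u * word_val v.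
Proof. exact: big_cat. Qed.

Lemma word_val_winv u : word_val (winv u) = (word_val u)^-1.
Proof.
elim: u => [|[x e] u IHu]; first by rewrite /word_val !big_nil invg1.
rewrite /winv /= rev_cons -cats1 word_val_cat IHu.
rewrite -[in RHS]cat1s word_val_cat invMg !word_val1.
by case: e; rewrite ?invgK.
Qed.

Lemma word_val_wconj u v : word_val (wconj u v) = word_val u ^ word_val v.
Proof. by rewrite !word_val_cat word_val_winv. Qed.

Lemma word_val_wcomm u v : word_val (wcomm u v) = [~ word_val u, word_val v].
Proof. by rewrite !word_val_cat !word_val_winv. Qed.

Hypothesis f_rel : forall u v, R u v -> word_val u = word_val v.

Lemma word_val_weq u v : weq R u v -> word_val u = word_val v.
Proof.
elim=> {u v} [//|u v _ -> //|u v w _ -> _ -> //|u u' v v' _ IHu _ IHv|x e|//].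
  by rewrite !word_val_cat IHu IHv.
rewrite /word_val !big_cons !big_nil /= mulg1.
by case: e; rewrite (mulgV, mulVg).
Qed.

Definition pres_lift (x : G) : H := word_val (repr x).

Lemma pres_lift_pi u : pres_lift (pres_pi u) = word_val u.
Proof. exact/word_val_weq/weq_repr. Qed.

Lemma pres_pi_surj (x : G) : exists u, x = pres_pi u.
Proof. by exists (repr x); rewrite /pres_pi reprK. Qed.

Lemma pres_liftM : {morph pres_lift : x y / x * y}.
Proof.
move=> x y; have [u ->] := pres_pi_surj x; have [v ->] := pres_pi_surj y.
by rewrite -pres_pi_cat !pres_lift_pi word_val_cat.
Qed.

(** A morphism that sends the images of the generators back to the generators is
    a left inverse: composed with the lift, it fixes every word.  This makes the
    lift injective without solving the word problem in the presented group. *)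
Lemma pres_lift_can (psi : H -> G) :
  {morph psi : x y / x * y} ->
  (forall x, psi (f x) = pres_pi [:: (x, true)]) ->
  cancel pres_lift psi.
Proof.
move=> psiM psif x; have [u ->] := pres_pi_surj x; rewrite pres_lift_pi.
have psi1 : psi 1 = 1 by apply: (mulgI (psi 1)); rewrite -psiM !mulg1.
have psiV y : psi y^-1 = (psi y)^-1.
  by apply/esym/mulg1_eq; rewrite -psiM mulgV.
elim: u => [|[y e] u IHu]; first by rewrite /word_val big_nil psi1.
rewrite -cat1s word_val_cat psiM IHu pres_pi_cat word_val1; congr (_ * _).
by case: e; rewrite ?psiV psif // -pres_pi_winv.
Qed.

End PresentedGroups.

(** * The cocycle of the group *)

Section Cocycle.

Variables m k : nat.
Hypothesis k_lt_m : (k < m)%N.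
Notation n := m.+1.
Notation V := 'rV[bool]_n.
Implicit Types (v w : V) (i j : 'I_n).
Local Open Scope ring_scope.

(** With indices from 0, a_i has square b_(i+k). *)
Definition sqr_ind i : 'I_n := Ordinal (ltn_pmod (i + k) (ltn0Sn m)).

(** The exponent vector of the commutator of a_i with a_0: it is b_(i-1) for
    1 <= i <= k, and trivial otherwise. *)
Definition conj_vec i : V :=
  if (0 < i <= k)%N then delta_mx 0 (inord i.-1) else 0.

(** The correction term in the product of the normal forms of v and w: squares
    a_i^2 appear wherever both have a 1, and moving the a_0 of w leftwards past
    the a_i of v costs one commutator for each of them. *)
Definition cocycle v w : V :=
  \sum_i (v 0 i * w 0 i) *: delta_mx 0 (sqr_ind i)
  + w 0 ord0 *: \sum_i v 0 i *: conj_vec i.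

Fact cocycle_bilinear : bilinear_for *:%R *:%R cocycle.
Proof.
split=> [w a v v'|v a w w']; rewrite /cocycle /= scalerDr addrACA;
  congr (_ + _).
- rewrite scaler_sumr -big_split; apply: eq_bigr => i _.
  by rewrite /= scalerA -scalerDl !mxE mulrDl mulrA.
- rewrite scalerA [a * _]mulrC -scalerA -scalerDr; congr (_ *: _).
  rewrite scaler_sumr -big_split; apply: eq_bigr => i _.
  by rewrite /= !mxE scalerDl scalerA.
- rewrite scaler_sumr -big_split; apply: eq_bigr => i _.
  by rewrite /= scalerA -scalerDl !mxE mulrDr mulrCA.
by rewrite scalerA -scalerDl !mxE.
Qed.

HB.instance Definition _ := bilinear_isBilinear.Build bool V V V _ _ cocycle
  cocycle_bilinear.

Lemma sum_delta_scale i (F : 'I_n -> V) :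
  \sum_j (delta_mx 0 i : V) 0 j *: F j = F i.
Proof.
rewrite (bigD1 i) //= big1 => [|j ji]; first by rewrite mxE !eqxx scale1r addr0.
by rewrite mxE (negPf ji) andbF scale0r.
Qed.

Lemma cocycle_delta i j :
  cocycle (delta_mx 0 i) (delta_mx 0 j) =
  (if i == j then delta_mx 0 (sqr_ind i) else 0)
  + (if j == ord0 then conj_vec i else 0).
Proof.
rewrite /cocycle sum_delta_scale -!scale_bool; congr (_ + _); last first.
  by rewrite mxE eqxx eq_sym; case: eqP.
under eq_bigr do rewrite -scalerA.
by rewrite sum_delta_scale mxE eqxx; case: eqP.
Qed.

Lemma sqr_ind_inj : injective sqr_ind.
Proof.
move=> i j /(congr1 val) /= /eqP; rewrite eqn_modDr => /eqP.
by rewrite !modn_small // => /val_inj.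
Qed.

(** The coordinate sqr_ind i = i + k mod n is at least k unless i + k wraps
    around, so it carries the commutator of a_j only for j = i + k + 1 - n, and
    then j < i because k + 1 < n. *)
Lemma conj_vec_sqr_ind i j : conj_vec j 0 (sqr_ind i) -> (j < i)%N.
Proof.
rewrite /conj_vec; case: ifP => [jk|_]; last by rewrite mxE.
rewrite mxE eqxx -val_eqE /= inordK; last by have := ltn_ord j; lia.
case: eqP => // ij _; move: ij.
have [ikn|le_n] := ltnP (i + k) n; first by rewrite modn_small //; lia.
have lti := ltn_ord i.
by rewrite -[(i + k)%N](subnK le_n) modnDr modn_small; lia.
Qed.

Lemma cocycle_sqr_ind v i :
  cocycle v v 0 (sqr_ind i) =
  v 0 i + v 0 ord0 * \sum_j v 0 j * conj_vec j 0 (sqr_ind i).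
Proof.
rewrite /cocycle !mxE !summxE; congr (_ + _ * _); last first.
  by apply: eq_bigr => j _; rewrite mxE.
rewrite (bigD1 i) //= big1 => [|j ji].
  by rewrite !mxE !eqxx mulr1 addr0; case: (v 0 i).
by rewrite !mxE (inj_eq sqr_ind_inj) eq_sym (negPf ji) andbF mulr0.
Qed.

(** Coordinate sqr_ind i of cocycle v v is v_i plus v_0 times a linear function
    of the v_j with j < i, so v is recovered coordinate by coordinate; for i = 0
    that linear function is zero. *)
Lemma cocycle_sqr_inj : injective (fun v => cocycle v v).
Proof.
move=> v w qvw; apply/rowP=> -[i lti]; elim/ltn_ind: i lti => i IH lti.
set I := Ordinal lti.
have := congr1 (fun x : V => x 0 (sqr_ind I)) qvw; rewrite /= !cocycle_sqr_ind.
have -> : \sum_j v 0 j * conj_vec j 0 (sqr_ind I) =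
          \sum_j w 0 j * conj_vec j 0 (sqr_ind I).
  apply: eq_bigr => -[j ltj] _.
  case cj: (conj_vec _ 0 (sqr_ind I)); last by rewrite !mulr0.
  by rewrite IH // (conj_vec_sqr_ind cj).
suff -> : v 0 ord0 * \sum_j w 0 j * conj_vec j 0 (sqr_ind I) =
          w 0 ord0 * \sum_j w 0 j * conj_vec j 0 (sqr_ind I) by apply: addIr.
have [i0|i_gt0] := posnP i; last by congr (_ * _); apply: (IH 0%N).
rewrite big1 ?mulr0 // => j _; case cj: (conj_vec j 0 (sqr_ind I)).
  by have := conj_vec_sqr_ind cj; rewrite /= i0.
by rewrite mulr0.
Qed.

End Cocycle.

(** * Normal forms *)

(** The elements a_i and b_i live in an arbitrary group and satisfy the
    relations, so that the computation with normal forms is independent of how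
    the presented group is built. *)
Section NormalForm.

Variables (m k : nat) (G : groupType).
Notation n := m.+1.
Notation V := 'rV[bool]_n.
Implicit Types (v w x y : V) (i j : 'I_n).
Local Open Scope group_scope.

Variables a b : 'I_n -> G.

Definition bexp x : G := \prod_i b i ^+ x 0%R i.

Hypothesis b_sqr : forall i, b i * b i = 1.
Hypothesis b_b : forall i j, commute (b i) (b j).
Hypothesis b_a : forall i j, commute (b i) (a j).

Lemma bexpD x y : bexp (x + y)%R = bexp x * bexp y.
Proof.
rewrite -prodgM_commute => [|i j _ _]; last exact: commuteX2.
apply: eq_bigr => i _; rewrite mxE.
by case: (x 0%R i); case: (y 0%R i); rewrite /= ?mulg1 ?mul1g ?b_sqr.
Qed.

Lemma bexp0 : bexp 0%R = 1.
Proof. by apply: big1 => i _; rewrite mxE. Qed.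

Lemma bexp_delta i : bexp (delta_mx 0%R i) = b i.
Proof.
rewrite /bexp (big_only1 i) // => [|j ji _]; first by rewrite mxE !eqxx.
by rewrite mxE (negPf ji) andbF.
Qed.

Lemma bexpZ (e : bool) x : bexp (e *: x)%R = bexp x ^+ e.
Proof. by rewrite scale_bool; case: e; rewrite ?bexp0. Qed.

Lemma bexp_sum (P : pred 'I_n) (x : 'I_n -> V) :
  bexp (\sum_(i | P i) x i)%R = \prod_(i | P i) bexp (x i).
Proof. exact: (big_morph bexp bexpD bexp0). Qed.

Lemma commute_bexp (g : G) x :
  (forall i, commute (b i) g) -> commute (bexp x) g.
Proof.
by move=> bg; apply/commute_sym/commute_prod => i _; apply/commuteX/commute_sym.
Qed.

Lemma bexp_a x i : commute (bexp x) (a i).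
Proof. exact: commute_bexp. Qed.

Lemma bexp_bexp x y : commute (bexp x) (bexp y).
Proof. by apply: commute_bexp => i; apply/commute_sym/commute_bexp. Qed.

(** The factors with i != 0 commute with each other; a_0 is the only generator
    whose position matters, and is kept in front. *)
Definition tail v : G := \prod_(i | i != ord0) a i ^+ v 0%R i.
Definition aexp v : G := a ord0 ^+ v 0%R ord0 * tail v.

Lemma bexp_tail x v : commute (bexp x) (tail v).
Proof. by apply: commute_prod => i _; apply/commuteX/bexp_a. Qed.

Lemma bexp_aexp x v : commute (bexp x) (aexp v).
Proof. by apply: commuteM; [apply/commuteX/bexp_a|apply: bexp_tail]. Qed.

Hypothesis a_sqr : forall i, a i * a i = b (sqr_ind k i).
Hypothesis a_a : forall i j, i != ord0 -> j != ord0 -> commute (a i) (a j).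
Hypothesis a_conj : forall i, i != ord0 ->
  a i ^ a ord0 = a i * bexp (conj_vec k i).

Lemma aXM i (e f : bool) :
  a i ^+ e * a i ^+ f =
  a i ^+ (e + f)%R * bexp ((e * f) *: delta_mx 0 (sqr_ind k i))%R.
Proof.
rewrite bexpZ bexp_delta -a_sqr.
by case: e; case: f; rewrite /= ?mulg1 ?mul1g.
Qed.

Lemma tailM v w : tail v * tail w = tail (v + w)%R *
  bexp (\sum_(i | i != ord0) (v 0 i * w 0 i) *: delta_mx 0 (sqr_ind k i))%R.
Proof.
rewrite bexp_sum -!prodgM_commute => [|i j _ _|i j i0 j0].
- by apply: eq_bigr => i _; rewrite aXM mxE.
- by apply/commute_sym/commuteX/bexp_a.
by apply: commuteX2; apply: a_a.
Qed.

Lemma tailJ v : tail v ^ a ord0 =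
  tail v * bexp (\sum_i v 0 i *: conj_vec k i)%R.
Proof.
rewrite (bigD1 ord0) //= scaler0 add0r bexp_sum -prodgM_commute => [|i j _ _].
  rewrite conjg_prod; apply: eq_bigr => i i0.
  by rewrite conjXg a_conj // expgMn ?bexpZ //; apply/commute_sym/bexp_a.
by apply/commute_sym/commuteX/bexp_a.
Qed.

(** Only two kinds of central factors arise: conjugating the tail of v by the
    a_0 of w gives the commutators, and merging equal generators the squares. *)
Lemma aexpM v w : aexp v * aexp w = aexp (v + w)%R * bexp (cocycle k v w).
Proof.
set c := (\sum_i v 0 i *: conj_vec k i)%R.
have swap (e : bool) :
  tail v * a ord0 ^+ e = a ord0 ^+ e * (tail v * bexp (e *: c)%R).
  rewrite bexpZ; case: e => /=; last by rewrite !mulg1 mul1g.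
  by rewrite conjgC tailJ.
rewrite /aexp -mulgA [tail v * _]mulgA swap -!mulgA.
rewrite [bexp _ * tail w]bexp_tail [tail v * (tail w * _)]mulgA tailM.
rewrite [RHS]mulgA mulgA aXM /cocycle [in RHS](bigD1 ord0) //= -/c.
rewrite !bexpD !mulgA mxE.
do 2!congr (_ * _); rewrite -!mulgA; congr (_ * _).
exact: bexp_tail.
Qed.

Definition normal_form (x : twist (cocycle k)) : G := aexp x.1 * bexp x.2.

Lemma normal_formM : {morph normal_form : x y / x * y}.
Proof.
move=> [v x] [w y]; rewrite /normal_form twistM /= 2!bexpD.
have := bexp_aexp x w; have := aexpM v w => /=.
have := commute_sym (commuteM (bexp_bexp (cocycle k v w) x)
                              (bexp_bexp (cocycle k v w) y)).
move: (aexp v) (aexp w) (aexp (v + w)%R) => A1 A2 A.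
move: (bexp x) (bexp y) (bexp (cocycle k v w)) => X Y Z XYZ A12 XA2.
by rewrite XYZ mulgA -A12 -!mulgA [X * (A2 * Y)]mulgA XA2 -mulgA.
Qed.

Lemma normal_form_a i : normal_form (delta_mx 0 i, 0)%R = a i.
Proof.
rewrite /normal_form /= bexp0 mulg1 /aexp mxE.
have [->|i0] := eqVneq i ord0.
  by rewrite /tail big1 ?mulg1 // => j j0; rewrite mxE (negPf j0) andbF.
rewrite andbF mul1g /tail (big_only1 i) // => [|j ji _].
  by rewrite mxE !eqxx.
by rewrite mxE (negPf ji) andbF.
Qed.

Lemma normal_form_b i : normal_form (0, delta_mx 0 i)%R = b i.
Proof.
rewrite /normal_form /= bexp_delta /aexp mxE mul1g /tail big1 ?mul1g // => j _.
by rewrite mxE.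
Qed.

End NormalForm.

(** * The isomorphism with the twisted product *)

Section Isomorphism.

Variables m k : nat.
Notation n := m.+1.
Notation V := 'rV[bool]_n.
Notation K := (twist (cocycle k : {bilinear V -> V -> V}%R)).
Implicit Types i j : 'I_n.
Local Open Scope group_scope.

Let a i : Ggroup n k := pres_pi (Grel k) (ga i).
Let b i : Ggroup n k := pres_pi (Grel k) (gb i).

Lemma conj_vec_pred i j : val j = i.+1 -> j <= k ->
  conj_vec k j = delta_mx 0%R i.
Proof. by move=> ji jk; rewrite /conj_vec jk ji inord_val. Qed.

Lemma Ggroup_b_sqr i : b i * b i = 1.
Proof. by rewrite -pres_pi_cat (pres_pi_rel (Grel_b_sqr k i)). Qed.

Lemma Ggroup_b_b i j : commute (b i) (b j).
Proof.
by apply/commgP; rewrite -pres_pi_wcomm (pres_pi_rel (Grel_b_b k i j)).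
Qed.

Lemma Ggroup_b_a i j : commute (b i) (a j).
Proof.
by apply/commgP; rewrite -pres_pi_wcomm (pres_pi_rel (Grel_b_a k i j)).
Qed.

Lemma Ggroup_a_sqr i : a i * a i = b (sqr_ind k i).
Proof. by rewrite -pres_pi_cat; apply/pres_pi_rel/Grel_sqr. Qed.

Lemma Ggroup_a_a i j : i != ord0 -> j != ord0 -> commute (a i) (a j).
Proof.
move=> i0 j0; apply/commgP; rewrite -pres_pi_wcomm.
by rewrite (pres_pi_rel (Grel_comm k _ _)) // lt0n.
Qed.

Lemma Ggroup_a_conj i : i != ord0 ->
  a i ^ a ord0 = a i * bexp b (conj_vec k i).
Proof.
move=> i0; have i_gt0 : 0 < i by rewrite lt0n.
rewrite -pres_pi_wconj; have [ik|ki] := leqP i k.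
  have i_pred : val i = (inord i.-1 : 'I_n).+1.
    by rewrite inordK ?prednK // ltnW.
  rewrite (conj_vec_pred i_pred ik) bexp_delta -pres_pi_cat.
  exact/pres_pi_rel/Grel_conj.
rewrite /conj_vec [i <= k]leqNgt ki andbF bexp0 mulg1 pres_pi_wconj.
apply/conjg_fixP; rewrite -invgR invg_eq1 -pres_pi_wcomm.
by rewrite (pres_pi_rel (Grel_comm1 _ ki)).
Qed.

Definition letter (s : 'I_n + 'I_n) : K :=
  match s with
  | inl i => (delta_mx 0 i, 0)%R
  | inr j => (0, delta_mx 0 j)%R
  end.

Lemma letter_rel u v : Grel k u v -> word_val letter u = word_val letter v.
Proof.
have va i : word_val letter (ga i) = letter (inl i) by rewrite word_val1.
have vb i : word_val letter (gb i) = letter (inr i) by rewrite word_val1.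
have v1 : word_val letter [::] = 1 by rewrite /word_val big_nil.
have shift0 (i : 'I_n) : i = ord0 -> conj_vec k i = 0%R by move=> ->.
have eq0 (i : 'I_n) : 0 < i -> (i == ord0) = false.
  by rewrite lt0n => /negPf.
case=> {u v} [i j ij|z i j z0 ji jk|z j z0 kj|i j i0 j0|i|i j|i j];
  rewrite ?word_val_wcomm ?word_val_wconj ?word_val_cat ?va ?vb ?v1.
- rewrite twistM /= cocycle_delta eqxx addvv_binary !addr0 add0r.
  have -> : j = sqr_ind k i by apply: val_inj.
  by have [/shift0->|_] := eqVneq i ord0; rewrite !addr0.
- have {z0} -> : z = ord0 by apply: val_inj.
  (* Cancelling a_0 turns a_j ^ a_0 = a_j b_i into a_j a_0 = a_0 a_j b_i. *)
  apply: (mulgI (letter (inl ord0))); rewrite -conjgC !twistM /=.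
  rewrite linear0r !addr0 !add0r !cocycle_delta (conj_vec_pred ji jk) eqxx.
  have j0 : (j == ord0) = false by rewrite eq0 // [nat_of_ord j]ji.
  by rewrite [ord0 == j]eq_sym j0 !addr0 add0r addrC.
- have {z0} -> : z = ord0 by apply: val_inj.
  apply/eqP/commgP/twist_commute => /=; rewrite !cocycle_delta.
  have j0 : (j == ord0) = false by rewrite eq0 // (leq_ltn_trans _ kj).
  by rewrite [ord0 == j]eq_sym j0 eqxx /conj_vec [j <= k]leqNgt kj andbF.
- apply/eqP/commgP/twist_commute => /=; rewrite !cocycle_delta !eq0 //.
  by rewrite [j == i]eq_sym; have [->|] := eqVneq i j.
- by rewrite twistM /= linear0l !addr0 addvv_binary.
- by apply/eqP/commgP/twist_commute; rewrite /= linear0l linear0r.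
by apply/eqP/commgP/twist_commute.
Qed.

Definition to_twist : Ggroup n k -> K := pres_lift letter.

Lemma to_twistM : {morph to_twist : x y / x * y}.
Proof. exact: pres_liftM letter_rel. Qed.

HB.instance Definition _ :=
  isMultiplicative.Build (Ggroup n k) K to_twist to_twistM.

Lemma to_twistK : cancel to_twist (normal_form a b).
Proof.
apply: (pres_lift_can letter_rel) => [|[i|j]] /=.
- apply: normal_formM.
  + exact: Ggroup_b_sqr.
  + exact: Ggroup_b_b.
  + exact: Ggroup_b_a.
  + exact: Ggroup_a_sqr.
  + exact: Ggroup_a_a.
  exact: Ggroup_a_conj.
- exact: normal_form_a.
exact: normal_form_b.
Qed.

(** The image is closed under products and contains generators of the fibre and
    of the quotient by it. *)
Lemma to_twist_surj (x : K) : exists g, to_twist g = x.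
Proof.
have ev (s : 'I_n + 'I_n) :
  to_twist (pres_pi (Grel k) [:: (s, true)]) = letter s.
  by rewrite /to_twist pres_lift_pi ?word_val1 //; apply: letter_rel.
have ev1 : to_twist 1 = 1.
  by apply: (mulgI (to_twist 1)); rewrite -to_twistM !mulg1.
have lift_b y : exists g, to_twist g = (0, y)%R.
  move: y; apply: span_binary => [|y z [g gy] [h hz]|j].
  - by exists 1.
  - by exists (g * h); rewrite to_twistM gy hz twistM /= linear0l !addr0.
  by exists (b j); rewrite ev.
have lift_v v : exists g, (to_twist g).1 = v.
  move: v; apply: span_binary => [|v w [g gv] [h hw]|i].
  - by exists 1; rewrite ev1.
  - by exists (g * h); rewrite to_twistM twistM /= gv hw.
  by exists (a i); rewrite ev.
case: x => v y; have [g gv] := lift_v v.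
have [h hy] := lift_b ((to_twist g).2 + y)%R; exists (g * h).
by rewrite to_twistM hy twistM /= linear0r !addr0 gv addVK_binary.
Qed.

Lemma to_twist_bij : bijective to_twist.
Proof.
exists (normal_form a b); first exact: to_twistK.
by move=> x; have [g <-] := to_twist_surj x; rewrite to_twistK.
Qed.

End Isomorphism.

Theorem theorem1p6 (n k : nat) (hn : 2 <= n) (hk : k < n - 1) :
  exists v kappa lambda : nat,
    rel_skew_hadamard_group (Ggroup n k) v kappa lambda.
Proof.
case: n hn hk => // m _; rewrite subn1 /= => k_lt_m.
pose V := 'rV[bool]_m.+1.
pose B : {bilinear V -> V -> V}%R := cocycle k.
pose h := fun v : V => tail_flip (B v v).
have h_inj : injective h.
  by move=> v w /tail_flip_inj; apply: cocycle_sqr_inj.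
have h0 : h 0%R = 0%R by rewrite /h linear0l tail_flip0.
have h_sqr v : v != 0%R -> dot (h v) (B v v).
  move=> v0; apply: dot_tail_flip; apply: contra v0 => /eqP Bv0.
  by apply/eqP/(cocycle_sqr_inj k_lt_m); rewrite linear0l.
do 3!eexists; exists (twist B), (@to_twist m k : {multiplicative _ -> _}).
split; first exact: to_twist_bij.
do 2!eexists; exact: (mcfarland_rel_skew_hadamard h_inj h0 h_sqr).
Qed.
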